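(* Let $k \geq 3$ and let $\mathcal{A}$ be a finite relational structure on the language $\{R\}$ with a single $k$-ary relation symbol $R$, where $R^{\mathcal{A}}$ is irreflexive, and $|\operatorname{dom}(\mathcal{A})| = n \geq k$. Then there is a simple structure $\mathcal{A}^*$ on the language $\{R\}$, with $R^{\mathcal{A}^*}$ irreflexive, $\operatorname{dom}(\mathcal{A}^* ) = \operatorname{dom}(\mathcal{A}) \cup \{x\}$ for a new element $x$, and $R^{\mathcal{A}^*} \cap \operatorname{dom}(\mathcal{A})^k = R^{\mathcal{A}}$.
   Context: A $k$-ary relation $R$ is irreflexive if no tuple in $R$ has two equal entries. For a structure $\mathcal{B}$ with ground set $B$ and $k$-ary relation $R^{\mathcal{B}}$, a set $I \subseteq B$ is an interval if for every position $i \in \{1,\dots,k\}$, all $x,y \in I$ and all $(k-1)$-tuples $(x_1,\ldots,x_{i-1},x_{i+1},\ldots,x_k) \in B^{k-1}\setminus I^{k-1}$, we have $(x_1,\ldots,x_{i-1},x,x_{i+1},\ldots,x_k) \in R^{\mathcal{B}} \iff (x_1,\ldots,x_{i-1},y,x_{i+1},\ldots,x_k) \in R^{\mathcal{B}}$. The empty set, singletons and $B$ are intervals; others are proper. The structure is simple if it has no proper intervals. *)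

(* Defs.v *)
From mathcomp Require Import all_boot.

Set Implicit Arguments.
Unset Strict Implicit.
Unset Printing Implicit Defensive.

(* A finite structure on the language {R}, with R a k-ary relation symbol, is  *)
(* given by its ground set B : finType and its relation R : {set k.-tuple B}.  *)

Definition irreflexive_rel (k : nat) (B : finType) (R : {set k.-tuple B}) : Prop :=
  forall t : k.-tuple B, t \in R -> uniq t.

(* (s_1, ..., s_(i-1), x, s_(i+1), ..., s_k), where the entries of the         *)
(* (k-1)-tuple s are indexed by the positions other than i, in order.          *)
Definition insert_at (k : nat) (B : Type) (i : 'I_k) (x : B)
    (s : k.-1.-tuple B) : k.-tuple B :=
  [tuple if unlift i j is Some j' then tnth s j' else x | j < k].

Definition interval (k : nat) (B : finType) (R : {set k.-tuple B})
    (I : {set B}) : Prop :=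
  forall (i : 'I_k) (x y : B) (s : k.-1.-tuple B),
    x \in I -> y \in I -> ~~ all [in I] s ->
    (insert_at i x s \in R <-> insert_at i y s \in R).

Definition proper_interval (k : nat) (B : finType) (R : {set k.-tuple B})
    (I : {set B}) : Prop :=
  [/\ interval R I, I <> set0, ~ (exists a : B, I = [set a]) & I <> [set: B]].

Definition simple_structure (k : nat) (B : finType) (R : {set k.-tuple B}) : Prop :=
  ~ exists I : {set B}, proper_interval R I.

(* Main.v *)
Require Import Defs.
From mathcomp Require Import all_boot.

Set Implicit Arguments.
Unset Strict Implicit.
Unset Printing Implicit Defensive.

(** Add to [R] every injective tuple that contains the new element [x]. Given an
    interval [I], distinct [a, b] in [I] and [c] outside [I] with [x] among them,
    some injective tuple [(a, b, c, ...)] is in the extended relation, whereas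
    [(b, b, c, ...)] is not; so [I] violates the interval condition at the first
    position. *)

(** Enough fresh entries lie outside [s]: as [s] has no repetition, its complement has
    [#|T| - size s] elements. *)
Lemma uniq_extend (T : finType) (k : nat) (s : seq T) :
  uniq s -> size s <= k <= #|T| ->
  exists r : seq T, uniq (s ++ r) /\ size (s ++ r) = k.
Proof.
move=> us /andP[sk kT].
exists (take (k - size s) (enum [predC s])); split.
  rewrite cat_uniq us take_uniq ?enum_uniq // andbT /=.
  by apply/hasPn => y /mem_take; rewrite mem_enum.
rewrite size_cat size_takel ?subnKC // -cardE leq_subLR.
by rewrite -(card_uniqP us) cardC.
Qed.

Lemma insert_at_ord0 (k : nat) (B : Type) (x : B) (s : k.-tuple B) :
  @insert_at k.+1 B ord0 x s = [tuple of x :: s].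
Proof.
apply: eq_from_tnth => j; rewrite tnth_mktuple.
by case: unliftP => [j' ->|->]; rewrite ?tnthS ?tnth0.
Qed.

(* The ground set of the extension is [option A]: [A] is identified with its   *)
(* image under [Some], and the new element is [None].                          *)
Theorem theorem7p3 (k n : nat) (A : finType) (R : {set k.-tuple A})
    (hk : 3 <= k) (hR : irreflexive_rel R) (hn : #|A| = n) (hkn : k <= n) :
  exists Rstar : {set k.-tuple (option A)},
    [/\ simple_structure Rstar,
        irreflexive_rel Rstar
      & Rstar :&: [set t : k.-tuple (option A) | all isSome t]
        = [set map_tuple Some t | t in R]].
Proof.
pose RS : {set k.-tuple (option A)} := [set map_tuple Some t | t in R].
pose X := [set t : k.-tuple (option A) | uniq t & None \in t].
have irr : irreflexive_rel (X :|: RS).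
  move=> t; rewrite !inE => /orP[/andP[]//|/imsetP[u uR ->]].
  by rewrite map_inj_uniq ?(hR _ uR) // => ? ? [].
exists (X :|: RS); split=> //; last first.
  apply/setP => t; rewrite -/RS !inE.
  have [/imsetP[u _ ->]|_] := boolP (t \in RS).
    by rewrite orbT; apply/allP => _ /mapP[y _ ->].
  (* [X] adds no tuple over [A], since each of its tuples contains [None]. *)
  rewrite orbF; apply/negbTE/negP => /andP[/andP[_ xt]].
  by move=> /allP/(_ _ xt).
case=> I [itvI I0 I1 IT].
have noncrossing a b c : a \in I -> b \in I -> c \notin I -> a != b ->
    None \in [:: a; b; c] -> False.
  move=> aI bI cI ab xabc.
  have uabc : uniq [:: a; b; c].
    by rewrite /= !inE negb_or ab /= andbT; apply/andP; split;
      apply: contraNneq cI => <-.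
  have [|r [ur sr]] := uniq_extend (k := k) uabc.
    by rewrite hk card_option hn leqW.
  have xr : None \in [:: a; b; c] ++ r by rewrite mem_cat xabc.
  (* The position [ord0] requires a successor length; [sr] rules out length zero. *)
  case: k {hk hR hkn} R @RS @X irr itvI sr => [//|k'] R' RS X irr itvI [sr].
  have szr : size [:: b, c & r] == k' by apply/eqP.
  have := itvI ord0 a b (Tuple szr) aI bI.
  rewrite !insert_at_ord0 /= (negbTE cI) andbF => /(_ isT)[abR _].
  have /abR/irr/= : [tuple of a :: Tuple szr] \in X :|: RS.
    by rewrite !inE; apply/orP; left; apply/andP; split.
  by rewrite inE eqxx.
(* If [None] is in [I], it serves as [a], and [c] is any point outside [I]. *)
have [xI|xNI] := boolP (None \in I).
  have [b bI bx] : exists2 b, b \in I & b != None.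
    apply/exists_inP; apply: contra_notT I1 => /exists_inPn h.
    exists None; apply/setP => y; rewrite inE.
    apply/idP/eqP => [/h|-> //]; by rewrite negbK => /eqP.
  have [c cI] : exists c, c \notin I.
    apply/existsP; apply: contra_notT IT => /existsPn h.
    by apply/setP => y; rewrite inE; move: (h y); rewrite negbK.
  by apply: (noncrossing None b c); rewrite // ?inE // eq_sym.
(* Otherwise [None] is the point outside [I], to be paired with any two distinct points of [I]. *)
have [a aI] : exists a, a \in I by apply/set0Pn/eqP.
have [b bI ba] : exists2 b, b \in I & b != a.
  apply/exists_inP; apply: contra_notT I1 => /exists_inPn h.
  exists a; apply/setP => y; rewrite inE.
  apply/idP/eqP => [/h|-> //]; by rewrite negbK => /eqP.
by apply: (noncrossing b a None); rewrite // !inE eqxx !orbT.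
Qed.
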